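(* For every graph $H$, there exist a constant $c > 0$ and a polynomial $n_0$ such that for every $p \in (0, 1/2]$ and every $n \geq n_0(1/p)$, every algorithm that solves the $(\mathcal{G}_{n,p},\rho_H)$-quality control problem has query complexity at least $c \cdot p^{-\Delta(H)/2}$.
   Context: Quality control: let $\mathcal{X}$ be a set, $\rho:\mathcal{X}\to\mathbb{R}_{\ge 0}$, $\varepsilon>0$ a fixed small constant, and $\mathcal{D}$ a distribution on $\mathcal{X}$ with $\Pr_{x\sim\mathcal{D}}[|\rho(x)-1|\le\varepsilon]\ge 9/10$. A (randomized) $(\mathcal{D},\rho)$-quality control algorithm $A$ must satisfy: (i) $\Pr_{x\sim\mathcal{D},R}[A(x)=\textsc{Accept}]\ge 2/3$, where $R$ is the algorithm's internal randomness; (ii) for every $x$ with $|\rho(x)-1|>\varepsilon$, $\Pr_R[A(x)=\textsc{Reject}]\ge 2/3$. Inputs are $n$-vertex graphs accessed via adjacency matrix queries ($(u,v)\mapsto 1$ iff $\{u,v\}$ is an edge); query complexity is the number of such queries. $\mathcal{G}_{n,p}$ is the Erdős–Rényi distribution. For a graph $H$, $C_H(G)$ is the number of labeled induced copies of $H$ in $G$ (injective maps $\psi:V(H)\to V(G)$ with $\{\psi(u),\psi(v)\}\in E(G)$ iff $\{u,v\}\in E(H)$), $\mu_H=\mathbb{E}_{G\sim\mathcal{G}_{n,p}}[C_H(G)]$, $\rho_H(G)=C_H(G)/\mu_H$, and $\Delta(H)$ is the maximum degree of $H$.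
   Formalization: H is required to have at least two vertices (for at most one vertex ρ_H is identically 1 and the always-accept algorithm makes 0 queries, so the claim fails); the ''small constant'' ε is taken as any fixed 0 < ε < 1. *)

(* Defs.v *)
From HB Require Import structures.
From mathcomp Require Import all_boot all_order all_algebra.
From mathcomp Require Import all_classical all_reals all_analysis.

Set Implicit Arguments.
Unset Strict Implicit.
Unset Printing Implicit Defensive.

Import Order.TTheory GRing.Theory Num.Theory.

Local Open Scope classical_set_scope.
Local Open Scope ring_scope.

Section SimpleGraph.
Variable V : finType.

Record sgraph := SGraph {
  edges : {set {set V}};
  edgesP : [forall e in edges, #|e| == 2%N] }.

HB.instance Definition _ := [isSub for edges].
HB.instance Definition _ := [Finite of sgraph by <:].

Definition adj (G : sgraph) (u v : V) : bool := [set u; v]%SET \in edges G.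

Lemma adj_sym (G : sgraph) : symmetric (adj G).
Proof. by move=> u v; rewrite /adj finset.setUC. Qed.

Lemma adj_irr (G : sgraph) : irreflexive (adj G).
Proof.
move=> u; apply/negP => uG; have /forall_inP/(_ _ uG) := edgesP G.
by rewrite finset.setUid cards1.
Qed.

Definition degree (G : sgraph) (v : V) : nat := #|[set w | adj G v w]%SET|.

Definition max_degree (G : sgraph) : nat := \max_(v : V) degree G v.

End SimpleGraph.

Definition induced_copy (V W : finType) (H : sgraph V) (G : sgraph W)
    (psi : {ffun V -> W}) : bool :=
  injectiveb psi && [forall u, forall v, adj G (psi u) (psi v) == adj H u v].

Definition copies (V W : finType) (H : sgraph V) (G : sgraph W) : nat :=
  #|[set psi : {ffun V -> W} | induced_copy H G psi]%SET|.

Section ErdosRenyi.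
Variables (R : realType) (n : nat) (p : R).

(* probability mass function of the random graph on 'I_n in which each
   unordered pair is an edge independently with probability p *)
Definition Gnp (G : sgraph 'I_n) : R :=
  \prod_(e : {set 'I_n} | #|e| == 2%N) (if e \in edges G then p else 1 - p).

Variables (V : finType) (H : sgraph V).

Definition mu : R := \sum_(G : sgraph 'I_n) Gnp G * (copies H G)%:R.

Definition rho (G : sgraph 'I_n) : R := (copies H G)%:R / mu.

Lemma Gnp_ge0 (G : sgraph 'I_n) : 0 <= p <= 1 -> 0 <= Gnp G.
Proof.
by move=> /andP[p0 p1]; apply: prodr_ge0 => e _; case: ifP; rewrite ?subr_ge0.
Qed.

Lemma Gnp_sum1 : \sum_(G : sgraph 'I_n) Gnp G = 1.
Proof.
pose Q (e : {set 'I_n}) := #|e| == 2%N.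
pose F (e : {set 'I_n}) (b : bool) := if b then p else 1 - p.
transitivity (\prod_(e | Q e) \sum_(b : bool) F e b); last first.
  by apply: big1 => e _; rewrite big_bool /F /= addrC subrK.
rewrite (big_distr_big_dep false Q (fun=> predT)) /=.
have gP (f : {ffun {set 'I_n} -> bool}) :
    [forall e in [set e | f e && Q e]%SET, #|e| == 2%N].
  by apply/forall_inP => e; rewrite inE => /andP[].
rewrite (reindex_onto
  (fun G : sgraph 'I_n => [ffun e => e \in edges G]) (fun f => SGraph (gP f))) /=.
  apply: eq_big => [G|G _].
    apply/esym/andP; split.
      apply/pfamilyP; split=> //; apply/fintype.subsetP => e; rewrite inE ffunE.
      rewrite eqbF_neg negbK => eG.
      by have /forall_inP/(_ _ eG) := edgesP G.
    apply/eqP/val_inj/finset.setP => e /=; rewrite inE ffunE.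
    case eG: (e \in edges G) => //=.
    by have /forall_inP/(_ _ eG) := edgesP G.
  by apply: eq_bigr => e _; rewrite /F ffunE.
move=> f /pfamilyP[/fintype.subsetP sf _]; apply/ffunP => e; rewrite ffunE inE.
case fe: (f e) => //=; apply: (sf e).
by rewrite inE fe.
Qed.

Lemma rho_ge0 (G : sgraph 'I_n) : 0 <= p <= 1 -> 0 <= rho G.
Proof.
move=> p01; rewrite divr_ge0// sumr_ge0// => G' _.
by rewrite mulr_ge0 ?Gnp_ge0.
Qed.

End ErdosRenyi.

Section AdjacencyQueries.
Variable n : nat.

(* deterministic adaptive algorithm making adjacency matrix queries *)
Inductive query_tree :=
| Leaf of bool (* true = Accept, false = Reject *)
| Query (u v : 'I_n) (if_nonedge if_edge : query_tree).

Fixpoint accepts (t : query_tree) (G : sgraph 'I_n) : bool :=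
  match t with
  | Leaf b => b
  | Query u v t0 t1 => accepts (if adj G u v then t1 else t0) G
  end.

Fixpoint num_queries (t : query_tree) (G : sgraph 'I_n) : nat :=
  match t with
  | Leaf _ => 0
  | Query u v t0 t1 => (num_queries (if adj G u v then t1 else t0) G).+1
  end.

(* T is the sample space of the internal randomness *)
Record randomized_algorithm (d : measure_display) (T : measurableType d) :=
  RandomizedAlgorithm {
    run :> T -> query_tree;
    measurable_accepts :
      forall G, measurable [set w : T | accepts (run w) G] }.

(* worst case over the inputs and the internal randomness *)
Definition query_complexity (R : realType) (d : measure_display)
    (T : measurableType d) (A : randomized_algorithm T) : \bar R :=
  ereal_sup [set (num_queries (A wG.1) wG.2)%:R%:E
            | wG in [set: T * sgraph 'I_n]].

End AdjacencyQueries.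

Section QualityControl.
Variables (R : realType) (X : finType) (eps : R) (D : X -> R) (rho : X -> R).

Definition quality_control_instance : Prop :=
  [/\ forall x, 0 <= D x,
      \sum_x D x = 1,
      forall x, 0 <= rho x
    & 9 / 10 <= \sum_(x | `|rho x - 1| <= eps) D x].

(* A w x is the verdict on input x with internal randomness w, true = Accept *)
Definition solves_quality_control (d : measure_display) (T : measurableType d)
    (P : probability T R) (A : T -> X -> bool) : Prop :=
  ((2 / 3)%:E <= \sum_(x : X) (D x)%:E * P [set w | A w x])%E /\
  (forall x, eps < `|rho x - 1| -> ((2 / 3)%:E <= P [set w | ~~ A w x])%E).

End QualityControl.

(* Main.v *)
(* Let v be a vertex of maximum degree D of H and let h = #|V|.  Reserve in 'I_n
   a disjoint block for every vertex of H, all of equal size, and cut the block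
   of v into m ~ p^-D / K pieces S_1, .., S_m.  To plant S_j in a graph G, join
   S_j completely to the blocks of the neighbours of v and to nothing else.
   Every copy of H - v in G that respects the blocks then extends to a copy of H
   through each vertex of S_j, without paying the factor p^D for the edges at v;
   by Chebyshev there are at least half the expected number of such copies of
   H - v, so all planted graphs have more than (1 + eps) mu copies of H and must
   be rejected.  A query meets at most two of the S_j, so an algorithm making q
   queries on G gives a different answer for at most 2 q of the m planted
   versions of G, whence q >= m / 20.  This yields the exponent D, which is
   better than the required D / 2.  When p^-D < K the bound is below 1, and no
   algorithm can do without queries because the empty or the complete graph has
   no copy of H. *)
Require Import Defs.
From HB Require Import structures.
From mathcomp Require Import all_boot all_order all_algebra.
From mathcomp Require Import all_classical all_reals all_analysis.
From mathcomp Require Import measurable_realfun ring lra.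

Set Implicit Arguments.
Unset Strict Implicit.
Unset Printing Implicit Defensive.

Import Order.TTheory GRing.Theory Num.Theory.

Local Open Scope ring_scope.

(** * Expectation over the random graph and independence of pairs *)

Section ErdosRenyiExpectation.
Variables (R : realType) (n : nat) (p : R).

Definition expect (X : sgraph 'I_n -> R) : R := \sum_G Gnp p G * X G.

Lemma eq_expect X Y : X =1 Y -> expect X = expect Y.
Proof. by move=> XY; apply: eq_bigr => G _; rewrite XY. Qed.

Lemma expectB X Y : expect (fun G => X G - Y G) = expect X - expect Y.
Proof. by rewrite /expect -sumrB; apply: eq_bigr => G _; rewrite mulrBr. Qed.

Lemma expectZ a X : expect (fun G => a * X G) = a * expect X.
Proof. by rewrite /expect mulr_sumr; apply: eq_bigr => G _; rewrite mulrCA. Qed.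

Lemma expect_cst a : expect (fun=> a) = a.
Proof. by rewrite /expect -mulr_suml Gnp_sum1 mul1r. Qed.

Lemma expect_sum (I : finType) (X : I -> sgraph 'I_n -> R) :
  expect (fun G => \sum_i X i G) = \sum_i expect (X i).
Proof.
rewrite /expect exchange_big; apply: eq_bigr => G _.
by rewrite mulr_sumr.
Qed.

(** Since [Gnp] is itself a product over pairs, the sum over graphs expands a product of two-term
    sums; this is independence of distinct pairs. *)
Lemma expect_prod (F : {set 'I_n} -> bool -> R) :
  expect (fun G => \prod_(e : {set 'I_n} | #|e| == 2%N) F e (e \in edges G)) =
  \prod_(e : {set 'I_n} | #|e| == 2%N) (p * F e true + (1 - p) * F e false).
Proof.
pose Q (e : {set 'I_n}) := #|e| == 2%N.
pose K (e : {set 'I_n}) (b : bool) := (if b then p else 1 - p) * F e b.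
transitivity (\prod_(e | Q e) \sum_(b : bool) K e b); last first.
  by apply: eq_bigr => e _; rewrite big_bool.
rewrite (big_distr_big_dep false Q (fun=> predT)) /=.
have gP (f : {ffun {set 'I_n} -> bool}) :
    [forall e in [set e | f e && Q e]%SET, #|e| == 2%N].
  by apply/forall_inP => e; rewrite inE => /andP[].
(* A graph is a Boolean function on sets that is false off the pairs. *)
rewrite (reindex_onto (fun G : sgraph 'I_n => [ffun e => e \in edges G])
  (fun f => SGraph (gP f))) /=.
  apply: eq_big => [G|G _].
    apply/esym/andP; split.
      apply/pfamilyP; split=> //; apply/fintype.subsetP => e.
      rewrite inE ffunE eqbF_neg negbK => eG.
      by have /forall_inP/(_ _ eG) := edgesP G.
    apply/eqP/val_inj/finset.setP => e /=; rewrite inE ffunE.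
    case eG: (e \in edges G) => //=.
    by have /forall_inP/(_ _ eG) := edgesP G.
  by rewrite /Gnp -big_split; apply: eq_bigr => e _; rewrite /K ffunE.
move=> f /pfamilyP[/fintype.subsetP sf _]; apply/ffunP => e; rewrite ffunE inE.
case fe: (f e) => //=; apply: (sf e).
by rewrite inE fe.
Qed.

Lemma expect_pattern (E : {set {set 'I_n}}) (b : {set 'I_n} -> bool) :
  (forall e, e \in E -> #|e| == 2%N) ->
  expect (fun G => [forall e in E, (e \in edges G) == b e]%:R) =
  \prod_(e in E) (if b e then p else 1 - p).
Proof.
move=> E2.
transitivity (expect (fun G => \prod_(e : {set 'I_n} | #|e| == 2%N)
    ((e \in E) ==> ((e \in edges G) == b e))%:R)).
  apply: eq_bigr => G _; congr (_ * _).
  case: forall_inP => [EG|EG].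
    by rewrite big1// => e _; case eE: (e \in E) => //=; rewrite EG.
  have [e eE eG] : exists2 e, e \in E & (e \in edges G) != b e.
    apply/exists_inP; rewrite -negb_forall_in; apply/negP => /forall_inP.
    exact: EG.
  by rewrite (bigD1 e) ?E2//= eE (negbTE eG) mul0r.
rewrite (expect_prod (fun e x => ((e \in E) ==> (x == b e))%:R)).
rewrite (bigID (mem E)) /= [X in _ * X]big1 ?mulr1; last first.
  by move=> e /andP[_ /negbTE ->] /=; rewrite !mulr1 addrC subrK.
rewrite (eq_bigl (mem E)) => [|e]; last first.
  by rewrite /= andbC; case eE: (e \in E) => //=; rewrite E2.
apply: eq_bigr => e eE; rewrite (eE : e \in E) /=.
by case: (b e); rewrite !(mulr1, mulr0) ?addr0 ?add0r.
Qed.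

Lemma expect_family (I : finType) (A : {set I}) (g : I -> {set 'I_n})
    (c : I -> bool) :
  {in A &, injective g} -> (forall i, i \in A -> #|g i| == 2%N) ->
  expect (fun G => [forall i in A, (g i \in edges G) == c i]%:R) =
  \prod_(i in A) (if c i then p else 1 - p).
Proof.
move=> gI g2; pose b e := [exists i in A, (g i == e) && c i].
have bg i : i \in A -> b (g i) = c i.
  move=> iA; apply/exists_inP/idP => [[j jA /andP[/eqP gij cj]]|ci].
    by rewrite -(gI _ _ jA iA gij).
  by exists i => //; rewrite eqxx.
transitivity (expect (fun G =>
    [forall e in [set g i | i in A]%SET, (e \in edges G) == b e]%:R)).
  apply: eq_bigr => G _; congr (_ * (_ : bool)%:R).
  apply/forall_inP/forall_inP => [h e /imsetP[i iA ->]|h i iA].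
    by rewrite bg// h.
  by rewrite -bg// h// imset_f.
rewrite expect_pattern => [|e /imsetP[i iA ->]]; last exact: g2.
by rewrite big_imset//; apply: eq_bigr => i iA; rewrite bg.
Qed.

Hypothesis p01 : 0 <= p <= 1.

Lemma ler_expect X Y : (forall G, X G <= Y G) -> expect X <= expect Y.
Proof. by move=> XY; apply: ler_sum => G _; rewrite ler_wpM2l ?Gnp_ge0. Qed.

(** Below half its mean, [X] has squared deviation at least a quarter of the squared mean. *)
Lemma chebyshev_expect (X : sgraph 'I_n -> R) (V : R) :
  0 < expect X -> expect (fun G => (X G - expect X) ^+ 2) <= V ->
  expect (fun G => (X G < expect X / 2)%R%:R) <= 4 * V / expect X ^+ 2.
Proof.
set M := expect X => M0 XV.
have M20 : 0 < M ^+ 2 by rewrite exprn_gt0.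
rewrite ler_pdivlMr// mulrC -ler_pdivrMl// mulrA -expectZ.
apply: le_trans XV; apply: ler_expect => G.
case: ltP => XM; last by rewrite mulr0 sqr_ge0.
rewrite mulr1 -subr_ge0.
have -> : (X G - M) ^+ 2 - 4^-1 * M ^+ 2 = (M / 2 - X G) * (3 * M / 2 - X G).
  by field.
rewrite mulr_ge0 ?subr_ge0 ?ltW//; apply: lt_trans XM _.
by lra.
Qed.

End ErdosRenyiExpectation.

(** * Probability that a map matches [H], and the expected number of copies *)

Section Matching.
Variables (R : realType) (n : nat) (p : R) (V : finType) (H : sgraph V).
Implicit Types (psi : V -> 'I_n) (Q : {set {set V}}) (v : V).

Definition weight Q : R :=
  \prod_(e in Q) (if e \in edges H then p else 1 - p).

Definition matches Q psi (G : sgraph 'I_n) : bool :=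
  [forall e in Q, (psi @: e \in edges G) == (e \in edges H)].

Definition pairs : {set {set V}} := [set e : {set V} | #|e| == 2%N]%SET.

Definition pairs_avoiding v : {set {set V}} :=
  [set e in pairs | v \notin e]%SET.

Lemma expect_matches Q psi : Q \subset pairs -> injective psi ->
  expect p (fun G => (matches Q psi G)%:R) = weight Q.
Proof.
move=> /fintype.subsetP Q2 psiI.
rewrite expect_family// => [e f _ _|e /Q2]; first exact: imset_inj.
by rewrite inE card_imset.
Qed.

Lemma expect_matches2 Q psi1 psi2 : Q \subset pairs ->
  injective psi1 -> injective psi2 ->
  (forall e f : {set V}, e \in Q -> f \in Q -> psi1 @: e != psi2 @: f) ->
  expect p (fun G => (matches Q psi1 G)%:R * (matches Q psi2 G)%:R) =
  weight Q ^+ 2.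
Proof.
move=> /fintype.subsetP Q2 psi1I psi2I psi12.
(* The two requirements form one family indexed by two copies of [Q]; by [psi12] its members are
   distinct pairs. *)
pose A := [set i : bool * {set V} | i.2 \in Q]%SET.
pose g (i : bool * {set V}) := (if i.1 then psi1 else psi2) @: i.2.
transitivity (expect p (fun G => [forall i in A,
    (g i \in edges G) == (i.2 \in edges H)]%:R)).
  apply: eq_bigr => G _; congr (_ * _); rewrite -natrM mulnb; congr (_%:R).
  congr nat_of_bool.
  apply/andP/forall_inP => [[/forall_inP h1 /forall_inP h2] [b e]|h].
    by rewrite inE /g; case: b; [exact: h1|exact: h2].
  split; apply/forall_inP => e eQ.
    by apply: (h (true, e)); rewrite inE.
  by apply: (h (false, e)); rewrite inE.
rewrite expect_family => [|[b e] [c f]|[b e]]; last first.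
- by rewrite inE /g => /Q2; rewrite inE; case: b; rewrite card_imset.
- rewrite !inE /g /= => eQ fQ; case: b c => -[] /= ef.
  + by rewrite (imset_inj psi1I ef).
  + by have /eqP := psi12 _ _ eQ fQ.
  + by have := psi12 _ _ fQ eQ; rewrite ef eqxx.
  + by rewrite (imset_inj psi2I ef).
rewrite (eq_bigl (fun i => predT i.1 && (i.2 \in Q))) => [|i]; last by rewrite inE.
rewrite -(pair_big predT (mem Q)
  (fun=> fun e => if e \in edges H then p else 1 - p)) /=.
by rewrite big_bool /= expr2.
Qed.

Lemma induced_copy_matches (G : sgraph 'I_n) (psi : {ffun V -> 'I_n}) :
  induced_copy H G psi = injectiveb psi && matches pairs psi G.
Proof.
rewrite /induced_copy; case: (injectiveP psi) => //= psiI.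
apply/forallP/forall_inP => [h e|h x].
  rewrite inE => /cards2P[x [y [_ ->]]]; rewrite imsetU !imset_set1.
  by have /forallP := h x; apply.
apply/forallP => y; have [<-|xy] := eqVneq x y; first by rewrite !adj_irr.
have := h [set x; y]%SET; rewrite inE cards2 xy imsetU !imset_set1.
exact.
Qed.

Hypothesis p01 : 0 < p <= 1 / 2.

Let p_gt0 : 0 < p. Proof. by case/andP: p01. Qed.
Let p_le : p <= 1 / 2. Proof. by case/andP: p01. Qed.
Let p_in01 : 0 <= p <= 1.
Proof. by rewrite ltW// (le_trans p_le)//; lra. Qed.

Let factor01 (b : bool) : 0 <= (if b then p else 1 - p) <= 1.
Proof. by move: p_gt0 p_le; case: b => ? ?; apply/andP; split; lra. Qed.

Lemma weight_gt0 Q : 0 < weight Q.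
Proof. by apply: prodr_gt0 => e _; move: p_gt0 p_le; case: ifP; lra. Qed.

(** Crude but uniform in [n] and [Q]; it makes the bound needed on [n] a polynomial in [1 / p]. *)
Lemma weight_lb Q : p ^+ #|{set V}| <= weight Q.
Proof.
apply: (@le_trans _ _ (p ^+ #|Q|)).
  by case/andP: p_in01 => ? ?; rewrite ler_wiXn2l ?max_card.
rewrite -prodr_const; apply: ler_prod => e _.
by move: p_gt0 p_le; case: ifP => _ ? ?; apply/andP; split; lra.
Qed.

(** The edges at [v] contribute [p] each, and the non-edges at [v] contribute factors at most 1. *)
Lemma weight_pairs v : weight pairs <= weight (pairs_avoiding v) * p ^+ degree H v.
Proof.
rewrite /weight (bigID (fun e : {set V} => v \notin e)) /=.
rewrite (eq_bigl (mem (pairs_avoiding v))) => [|e]; last by rewrite /= !inE.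
apply: ler_wpM2l; first exact/ltW/weight_gt0.
have vwI : {in [set w | adj H v w]%SET &, injective (fun w => [set v; w]%SET)}.
  move=> w w'; rewrite !inE => vw _ /finset.setP/(_ w).
  rewrite !inE eqxx orbT => /esym/orP[/eqP wv|/eqP//].
  by rewrite wv adj_irr in vw.
pose E := [set [set v; w]%SET | w in [set w | adj H v w]%SET]%SET.
have -> : p ^+ degree H v = \prod_(e in E) p.
  by rewrite prodr_const card_in_imset.
rewrite (bigID (mem E)) /=.
have h (e : {set V}) : e \in E ->
    [&& e \in pairs, v \in e & e \in edges H].
  move=> /imsetP[w]; rewrite inE => vw ->.
  rewrite !inE eqxx cards2 /= [_ \in edges H]vw.
  by case: (eqVneq v w) vw => // ->; rewrite adj_irr.
rewrite -[leRHS]mulr1; apply: ler_pM.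
- by apply: prodr_ge0 => e _; have /andP[] := factor01 (e \in edges H).
- by apply: prodr_ge0 => e _; have /andP[] := factor01 (e \in edges H).
- rewrite (eq_bigl (mem E)) => [|e]; last first.
    rewrite /=; case eE: (e \in E); rewrite ?andbF//.
    by have /and3P[-> -> _] := h _ eE.
  rewrite le_eqVlt; apply/orP; left; apply/eqP; apply: eq_bigr => e eE.
  by have /and3P[_ _ ->] := h _ eE.
- by apply: Num.Theory.prodr_ile1 => e _; exact: factor01.
Qed.

(** Non-injective maps contribute 0, so all [n ^ #|V|] maps may be counted with the weight of an
    injective one. *)
Lemma mu_ub v :
  mu n p H <= n%:R ^+ #|V| * (weight (pairs_avoiding v) * p ^+ degree H v).
Proof.
have -> : mu n p H =
    \sum_(psi : {ffun V -> 'I_n}) expect p (fun G => (induced_copy H G psi)%:R).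
  rewrite -expect_sum; apply: eq_bigr => G _; congr (_ * _).
  rewrite /copies -sum1_card natr_sum big_mkcond; apply: eq_bigr => psi _.
  by rewrite inE; case: induced_copy.
apply: (@le_trans _ _ (\sum_(psi : {ffun V -> 'I_n}) weight pairs)).
  apply: ler_sum => psi _; case: (boolP (injectiveb psi)) => [psiI|/negbTE psiI].
    rewrite -(expect_matches (fintype.subxx _) (injectiveP _ psiI)).
    by apply: ler_expect => // G; rewrite induced_copy_matches psiI.
  rewrite -[leLHS]/(\sum_G _) big1 ?ltW ?weight_gt0// => G _.
  by rewrite induced_copy_matches psiI mulr0.
rewrite sumr_const card_ffun card_ord -[leLHS]mulr_natl natrX.
by rewrite ler_wpM2l ?exprn_ge0 ?weight_pairs.
Qed.

End Matching.

(** * Block-respecting placements: mean, variance and lower tail *)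

Lemma sum_ffun_eq_at (V T : finType) (x : V) (t : T) :
  ((\sum_(g : {ffun V -> T}) (g x == t)) * #|T| = #|T| ^ #|V|)%N.
Proof.
have -> : (\sum_(g : {ffun V -> T}) (g x == t) =
    \prod_(y : V) \sum_(s : T) (if y == x then s == t else true))%N.
  rewrite bigA_distr_bigA; apply: eq_bigr => g _.
  by rewrite (bigD1 x)//= eqxx big1 ?muln1// => y /negbTE ->.
rewrite (bigD1 x)//= eqxx (bigD1 t)//= eqxx big1 => [|s /negbTE ->//].
rewrite addn0 mul1n.
under eq_bigr => y /negbTE -> do rewrite sum1_card.
rewrite prod_nat_const -expnSr; congr (_ ^ _)%N.
by rewrite cardC1 prednK//; apply/card_gt0P; exists x.
Qed.

Section PartiteCopies.
Variables (R : realType) (n : nat) (p : R) (V : finType) (H : sgraph V).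
(* [iota (x, t)] enumerates the block of 'I_n reserved for the vertex [x]. *)
Variables (T : finType) (iota : V * T -> 'I_n).
Hypothesis iotaI : injective iota.

Definition place (f : {ffun V -> T}) : {ffun V -> 'I_n} :=
  [ffun x => iota (x, f x)].

Lemma place_inj f : injective (place f).
Proof. by move=> x y; rewrite !ffunE => /iotaI[]. Qed.

Lemma iota_place x t f (e : {set V}) :
  (iota (x, t) \in place f @: e) = (x \in e) && (t == f x).
Proof.
apply/imsetP/andP => [[y ye]|[xe /eqP ->]].
  by rewrite ffunE => /iotaI[-> ->].
by exists x; rewrite ?ffunE.
Qed.

(** The value [f v] is unconstrained, so every copy of [H - v] is counted once for each point of the
    block of [v]. *)
Definition partite_copies v (G : sgraph 'I_n) : nat :=
  #|[set f | matches H (pairs_avoiding v) (place f) G]%SET|.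

Lemma partite_copiesE v G : (partite_copies v G)%:R =
  \sum_f (matches H (pairs_avoiding v) (place f) G)%:R :> R.
Proof.
rewrite /partite_copies -sum1_card natr_sum big_mkcond; apply: eq_bigr => f _.
by rewrite inE; case: matches.
Qed.

Lemma pairs_avoiding_pairs v : pairs_avoiding v \subset pairs V.
Proof. by apply/fintype.subsetP => e; rewrite inE => /andP[]. Qed.

Let wt v := weight p H (pairs_avoiding v).

Lemma expect_partite_copies v :
  expect p (fun G => (partite_copies v G)%:R) = (#|T| ^ #|V|)%:R * wt v.
Proof.
rewrite (eq_expect _ (partite_copiesE v)) expect_sum.
under eq_bigr => f _ do
  rewrite (expect_matches _ _ (pairs_avoiding_pairs v) (@place_inj f)).
by rewrite sumr_const card_ffun mulr_natl.
Qed.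

Hypothesis p01 : 0 < p <= 1 / 2.

Let p_in01 : 0 <= p <= 1.
Proof. by case/andP: p01 => ? ?; apply/andP; split; lra. Qed.

(* Placements that agree at no vertex use disjoint sets of pairs, hence are
   independent. *)
Lemma covariance_matches v f g :
  expect p (fun G => ((matches H (pairs_avoiding v) (place f) G)%:R - wt v) *
    ((matches H (pairs_avoiding v) (place g) G)%:R - wt v)) <=
  \sum_x (f x == g x)%:R.
Proof.
set X := fun f G => (matches H (pairs_avoiding v) (place f) G)%:R : R.
have EX f' : expect p (X f') = wt v.
  exact: (expect_matches _ _ (pairs_avoiding_pairs v) (@place_inj f')).
have -> : expect p (fun G => (X f G - wt v) * (X g G - wt v)) =
    expect p (fun G => X f G * X g G) - wt v ^+ 2.
  transitivity (expect p (fun G => X f G * X g G -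
      (wt v * X f G - (wt v ^+ 2 - wt v * X g G)))).
    by apply: eq_bigr => G _; congr (_ * _); ring.
  by rewrite !expectB !expectZ !EX expect_cst; ring.
have [/existsP[x fgx]|/existsPn fg] := boolP [exists x, f x == g x].
  rewrite (bigD1 x)//= fgx; apply: (@le_trans _ _ 1); last first.
    by rewrite lerDl sumr_ge0.
  rewrite lerBlDr (@le_trans _ _ 1)//; last by rewrite lerDl sqr_ge0.
  rewrite -[leRHS](@expect_cst R n p); apply: ler_expect => // G.
  by rewrite /X -natrM mulnb; case: (_ && _).
apply: (@le_trans _ _ 0); last by rewrite sumr_ge0.
rewrite subr_le0 /X (expect_matches2 _ _ (pairs_avoiding_pairs v) (@place_inj f) (@place_inj g))//.
(* The image of a vertex [x] of [e'] under [g] is not attained by [f]: blocks are disjoint and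
   [f x != g x]. *)
move=> e e' _; rewrite inE => /andP[]; rewrite inE => e'2 _.
have [x xe'] : exists x, x \in e'.
  by apply/set0Pn; rewrite -card_gt0 (eqP e'2).
apply/negP => /eqP/finset.setP/(_ (place g x)).
by rewrite imset_f// ffunE iota_place eq_sym (negbTE (fg x)) andbF.
Qed.

(** Only pairs of placements agreeing somewhere count, and for each vertex a fraction [1 / #|T|] of
    the pairs agree there. *)
Lemma variance_partite_copies v :
  expect p (fun G => ((partite_copies v G)%:R - (#|T| ^ #|V|)%:R * wt v) ^+ 2)
    * #|T|%:R <= #|V|%:R * (#|T| ^ #|V|)%:R ^+ 2.
Proof.
set X := fun f G => (matches H (pairs_avoiding v) (place f) G)%:R : R.
have -> : expect p (fun G =>
      ((partite_copies v G)%:R - (#|T| ^ #|V|)%:R * wt v) ^+ 2) =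
    \sum_f \sum_g expect p (fun G => (X f G - wt v) * (X g G - wt v)).
  under eq_bigr do rewrite -expect_sum.
  rewrite -expect_sum; apply: eq_bigr => G _; congr (_ * _).
  rewrite partite_copiesE -card_ffun mulr_natl -sumr_const -sumrB expr2.
  by rewrite mulr_suml; apply: eq_bigr => f _; rewrite mulr_sumr.
apply: (@le_trans _ _ ((\sum_(f : {ffun V -> T}) \sum_(g : {ffun V -> T})
    \sum_x (f x == g x)%:R) * #|T|%:R)).
  rewrite ler_wpM2r//; apply: ler_sum => f _; apply: ler_sum => g _.
  exact: covariance_matches.
rewrite mulr_suml.
under eq_bigr => f _.
  rewrite exchange_big /= mulr_suml.
  under eq_bigr => x _.
    under eq_bigr do rewrite eq_sym.
    rewrite -natr_sum -natrM sum_ffun_eq_at.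
  over.
  rewrite sumr_const.
over.
rewrite sumr_const card_ffun expr2 mulrA.
by rewrite -[leLHS]mulr_natr -[X in X * _ <= _]mulr_natl.
Qed.

Lemma partite_copies_lower_tail v : (0 < #|T|)%N ->
  expect p (fun G => ((partite_copies v G)%:R <
    (#|T| ^ #|V|)%:R * wt v / 2)%R%:R) <=
  4 * #|V|%:R / (#|T|%:R * wt v ^+ 2).
Proof.
move=> T0; have T0' : 0 < #|T|%:R :> R by rewrite ltr0n.
have TV0 : 0 < (#|T| ^ #|V|)%:R :> R by rewrite ltr0n expn_gt0 T0.
have wt0 : 0 < wt v by exact: weight_gt0.
have EY := expect_partite_copies v.
have /(chebyshev_expect p_in01) tail :
    0 < expect p (fun G => (partite_copies v G)%:R).
  by rewrite EY mulr_gt0.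
have := variance_partite_copies v; rewrite -ler_pdivlMr// -{1}EY => /tail.
rewrite EY => /le_trans; apply; rewrite le_eqVlt; apply/orP; left; apply/eqP.
by field; rewrite !gt_eqF.
Qed.

End PartiteCopies.

(** * Planting a piece of the block of [v] *)

Section Planting.
Variables (n : nat) (V : finType) (H : sgraph V) (v : V) (m b : nat).
Variable iota : V * ('I_m * 'I_b) -> 'I_n.
Hypothesis iotaI : injective iota.
Implicit Types (j : 'I_m) (G : sgraph 'I_n) (e : {set 'I_n}).

(* [iota (x, (j, i))] is the [i]-th vertex of the [j]-th piece of the block of
   [x]; only for [x = v] does the division into pieces matter. *)
Definition touched j e : bool := [exists i, iota (v, (j, i)) \in e].

Definition joined e : bool :=
  [exists x, adj H v x && [exists t, iota (x, t) \in e]].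

(** All pairs touching the piece are overwritten, with non-edges as well as edges, so that the new
    copies are induced. *)
Definition plant_edges j G : {set {set 'I_n}} :=
  [set e : {set 'I_n} | (#|e| == 2%N) &&
    (if touched j e then joined e else e \in edges G)]%SET.

Lemma plant_edgesP j G : [forall e in plant_edges j G, #|e| == 2%N].
Proof. by apply/forall_inP => e; rewrite inE => /andP[]. Qed.

Definition plant j G : sgraph 'I_n := SGraph (plant_edgesP j G).

Lemma adj_plant j G u w :
  ~~ touched j [set u; w]%SET -> adj (plant j G) u w = adj G u w.
Proof.
rewrite /adj inE => /negbTE ->; case uw: (_ \in edges G); rewrite ?andbF//.
by rewrite andbT; have /forall_inP/(_ _ uw) := edgesP G.
Qed.

(** The pieces are disjoint, so each point of [e] lies in at most one of them. *)
Lemma sum_touched e : (\sum_j touched j e <= #|e|)%N.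
Proof.
apply: (@leq_trans (\sum_j \sum_i (iota (v, (j, i)) \in e))).
  apply: leq_sum => j _; rewrite /touched.
  by case: existsP => // -[i ie]; rewrite (bigD1 i)//= ie.
rewrite pair_bigA /= -(big_mkcond (fun t => iota (v, (t.1, t.2)) \in e) (fun=> 1%N)).
rewrite sum1_card.
have I : injective (fun t : 'I_m * 'I_b => iota (v, (t.1, t.2))).
  by case=> [j i] [j' i'] /iotaI[-> ->].
rewrite -(card_imset _ I) subset_leq_card//; apply/fintype.subsetP => u.
by move=> /imsetP[t te ->].
Qed.

(** Follow the path of [t] on [G]: a planted graph leaves it only at a query whose pair touches its
    piece, and each query touches at most two pieces. *)
Lemma accepts_plant t G :
  (\sum_j (accepts t (plant j G) != accepts t G) <= 2 * num_queries t G)%N.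
Proof.
elim: t => [c|u w t0 IH0 t1 IH1] /=; first by rewrite big1// => j _; rewrite eqxx.
rewrite mulnS; apply: (@leq_trans (\sum_j touched j [set u; w]%SET +
    \sum_j (accepts (if adj G u w then t1 else t0) (plant j G)
            != accepts (if adj G u w then t1 else t0) G))).
  rewrite -big_split /=; apply: leq_sum => j _.
  have [tj|/adj_plant ->//] := boolP (touched j _).
  by rewrite (leq_trans (leq_b1 _))// leq_addr.
apply: leq_add; last by case: ifP.
by apply: leq_trans (sum_touched _) _; rewrite cards2; case: (u != w).
Qed.

(** On the left the image of [v] ranges over all [m] pieces, but planting completes a copy only
    through piece [j]; hence the factor [m]. *)
Lemma copies_plant j G :
  (partite_copies H iota v G <= m * copies H (plant j G))%N.
Proof.
(* A placement is determined by the piece containing the image of [v] and the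
   placement in which that image is moved to the piece [j]. *)
pose move_v (f : {ffun V -> 'I_m * 'I_b}) : {ffun V -> 'I_m * 'I_b} :=
  [ffun x => if x == v then (j, (f v).2) else f x].
pose phi (f : {ffun V -> 'I_m * 'I_b}) := ((f v).1, place iota (move_v f)).
have phiI : injective phi.
  move=> f g [fgv /ffunP fg]; apply/ffunP => x.
  have := fg x; rewrite !ffunE => /iotaI[]; case: eqVneq => [-> [fgv2]|//].
  by rewrite (surjective_pairing (f v)) fgv fgv2 -surjective_pairing.
rewrite /partite_copies -(card_imset _ phiI).
rewrite -[X in (_ <= X * _)%N]card_ord -cardsT -cardsX.
apply: subset_leq_card; apply/fintype.subsetP => y /imsetP[f]; rewrite inE.
move=> /forall_inP fG ->{y}; rewrite finset.in_setX finset.in_setT inE /=.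
rewrite induced_copy_matches; apply/andP; split.
  exact/injectiveP/place_inj.
apply/forall_inP => e e2; have := e2; rewrite inE => /eqP e2'.
rewrite inE card_imset ?e2' /=; last exact: place_inj.
(* A pair at [v] touches piece [j], and planting makes it an edge exactly when its other end is a
   neighbour of [v]. *)
have [ve|ve] := boolP (v \in e).
  have -> : touched j (place iota (move_v f) @: e).
    by apply/existsP; exists (f v).2; rewrite iota_place// ve ffunE !eqxx.
  have [w [wv ->]] : exists w, w != v /\ e = [set v; w]%SET.
    move/eqP/cards2P: e2' ve => [x [y [xy ->]]]; rewrite !inE.
    move=> /orP[] /eqP ->; first by exists y; rewrite eq_sym.
    by exists x; rewrite finset.setUC.
  apply/eqP; apply/existsP/idP => [[x /andP[vx /existsP[t]]]|vw].
    rewrite iota_place// !inE => /andP[/orP[] /eqP xE _].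
      by rewrite xE adj_irr in vx.
    by rewrite -xE.
  exists w; rewrite [adj _ _ _]vw; apply/existsP; exists (move_v f w).
  by rewrite iota_place// !inE !eqxx orbT.
(* A pair avoiding [v] misses piece [j] and is unaffected by moving the image of [v], so the match
   in [G] carries over. *)
have /negbTE -> : ~~ touched j (place iota (move_v f) @: e).
  by apply/existsPn => i; rewrite iota_place// (negbTE ve).
have -> : place iota (move_v f) @: e = place iota f @: e.
  apply: eq_in_imset => x xe; rewrite !ffunE; case: eqP => // xv.
  by rewrite -xv xe in ve.
by apply: fG; rewrite inE e2.
Qed.

End Planting.

(** * Auxiliary facts: embeddings, graphs without copies, sums of probabilities *)

Lemma inj_ord_exists (T : finType) (n : nat) :
  (#|T| <= n)%N -> exists f : T -> 'I_n, injective f.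
Proof.
move=> Tn; exists (fun x => widen_ord Tn (enum_rank x)) => x y [] /ord_inj.
exact: enum_rank_inj.
Qed.

(** The empty graph works if [H] has an edge; otherwise the complete graph does, as [H] then has two
    non-adjacent vertices. *)
Lemma copies0_exists (V : finType) (H : sgraph V) (n : nat) : (1 < #|V|)%N ->
  exists G : sgraph 'I_n, copies H G = 0%N.
Proof.
move=> V1; have emptyP : [forall e in finset.set0 : {set {set 'I_n}}, #|e| == 2%N].
  by apply/forall_inP => e; rewrite inE.
have fullP : [forall e in pairs 'I_n, #|e| == 2%N].
  by apply/forall_inP => e; rewrite inE.
have [/existsP[x /existsP[y xy]]|/existsPn nH] :=
    boolP [exists x, exists y, adj H x y].
  exists (SGraph emptyP); apply: eq_card0 => psi; rewrite !inE.
  apply/negP => /andP[_ /forallP/(_ x)/forallP/(_ y)].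
  by rewrite xy /adj inE.
exists (SGraph fullP); apply: eq_card0 => psi; rewrite !inE.
apply/negP => /andP[/injectiveP psiI /forallP psiG].
have /card_gt1P[x [y [_ _ xy]]] := V1.
have /existsPn/(_ y)/negbTE nxy := nH x.
have /forallP/(_ y) := psiG x; rewrite nxy eqbF_neg => /negP; apply.
by rewrite /adj inE cards2 (inj_eq psiI) xy.
Qed.

Lemma accepts_no_query (n : nat) (t : query_tree n) G G' :
  num_queries t G = 0%N -> accepts t G' = accepts t G.
Proof. by case: t. Qed.

(** The sum is the expected number of events [B i] that occur, and this number never exceeds [k]. *)
Lemma sum_probability_le (R : realType) (d : measure_display)
    (T : measurableType d) (P : probability T R) (I : finType)
    (B : I -> set T) (k : R) :
  (forall i, measurable (B i)) -> (forall w, \sum_i \1_(B i) w <= k) ->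
  (\sum_i P (B i) <= k%:E)%E.
Proof.
move=> mB Bk.
have -> : (\sum_i P (B i) = \sum_i \int[P]_w (\1_(B i) w)%:E)%E.
  by apply: eq_bigr => i _; rewrite integral_indic// setIT.
have mf i : measurable_fun setT (fun w => (\1_(B i) w : R)%:E).
  by apply/measurable_EFinP; exact: measurable_indic.
have f0 i w : setT w -> (0 <= (\1_(B i) w : R)%:E)%E by rewrite lee_fin.
rewrite -(ge0_integral_sum P measurableT mf f0).
apply: (@le_trans _ _ (\int[P]_w cst k%:E w)%E).
  apply: ge0_le_integral => //.
  - by move=> w _; apply: sume_ge0 => i _; rewrite lee_fin.
  - exact: emeasurable_sum.
  - by move=> w _; rewrite sumEFin lee_fin.
by rewrite integral_cst//= probability_setT mule1.
Qed.

(** * Acceptance probability of a fixed input *)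

Section AcceptanceProbability.
Variables (R : realType) (n : nat) (d : measure_display) (T : measurableType d).
Variables (P : probability T R) (A : randomized_algorithm n T).

Definition acc (G : sgraph 'I_n) : R := fine (P [set w | accepts (A w) G]%classic).

Lemma accE G : P [set w | accepts (A w) G]%classic = (acc G)%:E.
Proof. by rewrite fineK// fin_num_measure//; exact: measurable_accepts. Qed.

Lemma acc_le1 G : acc G <= 1.
Proof. by rewrite -lee_fin -accE probability_le1//; exact: measurable_accepts. Qed.

Lemma acc_reject G :
  ((2 / 3)%:E <= P [set w | ~~ accepts (A w) G]%classic)%E -> acc G <= 1 / 3.
Proof.
have -> : [set w | ~~ accepts (A w) G]%classic =
    (~` [set w | accepts (A w) G])%classic.
  by apply/seteqP; split => w /= /negP.
rewrite probability_setC ?accE -?EFinB ?lee_fin; first by lra.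
exact: measurable_accepts.
Qed.

Lemma acc_expect p : (\sum_G (Gnp p G)%:E * P [set w | accepts (A w) G]%classic)%E
  = (expect p acc)%:E.
Proof.
by rewrite /expect -sumEFin; apply: eq_bigr => G _; rewrite accE EFinM.
Qed.

(** This is [accepts_plant] averaged over the randomness; [B j] in the proof is the event of
    accepting [G] but not its planting at [j]. *)
Lemma acc_plant (V : finType) (H : sgraph V) (v : V) (m b : nat)
    (iota : V * ('I_m * 'I_b) -> 'I_n) (q : R) (G : sgraph 'I_n) :
  injective iota -> (forall w, (num_queries (A w) G)%:R <= q) ->
  m%:R * acc G <= \sum_j acc (plant H v iota j G) + 2 * q.
Proof.
move=> iotaI Aq.
pose E G' : set T := [set w | accepts (A w) G']%classic.
have mE G' : measurable (E G') by exact: measurable_accepts.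
pose B j := (E G `\` E (plant H v iota j G))%classic.
have mB j : measurable (B j) by exact: measurableD.
have BE j : P (B j) = (fine (P (B j)))%:E by rewrite fineK// fin_num_measure.
have Bq : \sum_j fine (P (B j)) <= 2 * q.
  rewrite -lee_fin -sumEFin; under eq_bigr do rewrite -BE.
  apply: sum_probability_le => // w.
  apply: (@le_trans _ _ (2 * num_queries (A w) G)%:R); last first.
    by rewrite natrM ler_wpM2l.
  have := accepts_plant H v iotaI (A w) G; rewrite -(ler_nat R); apply: le_trans.
  rewrite natr_sum; apply: ler_sum => j _; rewrite indicE ler_nat.
  case: (boolP (w \in B j)) => //; rewrite inE => -[/= aG /negP/negbTE ->].
  by rewrite aG.
apply: le_trans (lerD (lexx _) Bq); rewrite -big_split /=.
rewrite mulr_natl -[X in _ *+ X]card_ord -sumr_const; apply: ler_sum => j _.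
rewrite -lee_fin EFinD -BE -!accE -/(E _) -/(E _).
apply: le_trans (measureU2 _ _ _) => //; apply: le_measure; rewrite ?inE//.
  exact: measurableU.
by move=> w Ew; have [?|?] := pselect (E (plant H v iota j G) w); [left|right].
Qed.

End AcceptanceProbability.

(** * Lower bounds on the number of queries *)

Lemma planting_query_lower_bound (R : realType) (eps : R) (n : nat) (p : R)
    (V : finType) (H : sgraph V) (v : V) (m b : nat)
    (iota : V * ('I_m * 'I_b) -> 'I_n) (q : R)
    (d : measure_display) (T : measurableType d) (P : probability T R)
    (A : randomized_algorithm n T) :
  0 < p <= 1 / 2 -> injective iota -> (0 < m)%N -> (0 < b)%N ->
  0 < mu n p H ->
  (1 + eps) * mu n p H * m%:R <
    ((m * b) ^ #|V|)%:R * weight p H (pairs_avoiding v) / 2 ->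
  4 * #|V|%:R / ((m * b)%:R * weight p H (pairs_avoiding v) ^+ 2) <= 1 / 10 ->
  solves_quality_control eps (@Gnp R n p) (@rho R n p V H) P
    (fun w => accepts (A w)) ->
  (forall w G, (num_queries (A w) G)%:R <= q) ->
  m%:R < 20 * q.
Proof.
move=> p01 iotaI m0 b0 mu0 many tail [Aacc Arej] Aq.
have m0' : 0 < m%:R :> R by rewrite ltr0n.
have p_in01 : 0 <= p <= 1.
  by case/andP: p01 => ? ?; apply/andP; split; lra.
have T0 : (0 < #|{: 'I_m * 'I_b}|)%N by rewrite card_prod !card_ord muln_gt0 m0.
pose few G : R := ((partite_copies H iota v G)%:R <
  ((m * b) ^ #|V|)%:R * weight p H (pairs_avoiding v) / 2)%R%:R.
have few_le : expect p few <= 1 / 10.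
  have := partite_copies_lower_tail H iotaI p01 v T0.
  by rewrite card_prod !card_ord => /le_trans; exact.
(* If [G] has few partite copies, subtracting 1 makes the left side nonpositive. Otherwise every
   planted version must be rejected, and [acc_plant] is divided by [m]. *)
have acc_ub G : acc P A G - few G <= 1 / 3 + 2 * q / m%:R.
  rewrite /few; case: ltP => /= [_|Y_ge].
    have q0 : 0 <= q.
      (* The sample space has probability 1, hence is nonempty, so [q] bounds some number of
         queries. *)
      have [w _] : (@setT T !=set0)%classic.
        apply/set0P/negP => /eqP T_eq0; have := @probability_setT _ _ _ P.
        by rewrite T_eq0 measure0 => -[] /eqP; rewrite eq_sym oner_eq0.
      exact: le_trans (Aq w G).
    have : 0 <= 2 * q / m%:R by rewrite divr_ge0 ?mulr_ge0.
    by have := acc_le1 P A G; lra.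
  have accj j : acc P A (plant H v iota j G) <= 1 / 3.
    apply/acc_reject/Arej; rewrite (lt_le_trans _ (ler_norm _))//.
    rewrite ltrBrDl /rho ltr_pdivlMr// -(ltr_pM2r m0').
    apply: (lt_le_trans many); apply: (le_trans Y_ge).
    by rewrite -natrM ler_nat mulnC copies_plant.
  rewrite subr0 -(ler_pM2l m0').
  apply: le_trans (acc_plant P H v iotaI (fun w => Aq w G)) _.
  rewrite mulrDr [X in _ <= _ + X]mulrC divfK ?gt_eqF// lerD2r.
  apply: (le_trans (ler_sum _ (fun j _ => accj j))).
  by rewrite sumr_const card_ord mulr_natl.
move: Aacc; rewrite acc_expect lee_fin => Aacc.
have := ler_expect p_in01 acc_ub; rewrite expectB expect_cst.
move: Aacc few_le => ? ? ?.
(* The gap is [2/3 - 1/10 - 1/3 = 7/30], which exceeds [1/10]. *)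
have : 1 / 10 < 2 * q / m%:R by lra.
by rewrite ltr_pdivlMr//; lra.
Qed.

(** Without queries all graphs are accepted with the same probability, but a graph with no copies
    has [rho] equal to 0 and must be rejected. *)
Lemma zero_query_not_solving (R : realType) (eps : R) (n : nat) (p : R)
    (V : finType) (H : sgraph V)
    (d : measure_display) (T : measurableType d) (P : probability T R)
    (A : randomized_algorithm n T) :
  eps < 1 -> (1 < #|V|)%N ->
  (forall w G, num_queries (A w) G = 0%N) ->
  ~ solves_quality_control eps (@Gnp R n p) (@rho R n p V H) P
      (fun w => accepts (A w)).
Proof.
move=> eps1 V1 A0 [Aacc Arej]; have [G0 G0copies] := copies0_exists H n V1.
have accG0 : acc P A G0 <= 1 / 3.
  by apply/acc_reject/Arej; rewrite /rho G0copies mul0r add0r normrN normr1.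
have acc_const G : acc P A G = acc P A G0.
  congr fine; congr (P _); apply/seteqP.
  by split=> w /=; rewrite (accepts_no_query G (A0 w G0)).
move: Aacc; rewrite acc_expect lee_fin (eq_expect _ acc_const) expect_cst.
by lra.
Qed.

(** * Choice of the number and size of the pieces *)

(** In the application [u] is [mu], [w] is the weight of the pairs avoiding [v], [k] is [#|V|] and
    [L] is [#|{set V}|]. *)
Lemma planting_parameters (R : realType) (eps p w u : R) (n k D L : nat) :
  let K := 4 * (2 * k%:R) ^+ k in
  eps < 1 -> 0 < p -> (0 < k)%N -> K <= p ^- D ->
  80 * k%:R ^+ 2 <= n%:R * p ^+ (2 * L) -> k%:R * p ^- D <= n%:R ->
  p ^+ L <= w -> 0 < u <= n%:R ^+ k * (w * p ^+ D) ->
  exists m b : nat, [/\ (0 < m)%N, (0 < b)%N & (k * (m * b) <= n)%N] /\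
    [/\ p ^- D <= 2 * m%:R * K,
    (1 + eps) * u * m%:R < ((m * b) ^ k)%:R * w / 2 &
    4 * k%:R / ((m * b)%:R * w ^+ 2) <= 1 / 10].
Proof.
move=> K eps1 p0 k0 Kx n_ge2 n_ge1 pLw /andP[u0 u_le].
pose x := p ^- D; rewrite -/x in Kx n_ge1 *.
have xD : p ^+ D * x = 1 by rewrite mulfV// gt_eqF// exprn_gt0.
have x0 : 0 < x by rewrite invr_gt0 exprn_gt0.
have pL0 : 0 < p ^+ L by rewrite exprn_gt0.
have w0 : 0 < w by exact: lt_le_trans pLw.
have w_ge : p ^+ (2 * L) <= w ^+ 2.
  by rewrite mulnC exprM lerXn2r ?nnegrE ?(ltW pL0)// ltW.
have pD0 : 0 < p ^+ D by rewrite exprn_gt0.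
move: x (p ^+ D) (p ^+ (2 * L)) Kx n_ge1 n_ge2 xD x0 w_ge pD0 u_le {pLw pL0 p0}.
move=> x y z Kx n_ge1 n_ge2 xD x0 w_ge y0 u_le.
set h : R := k%:R; have h1 : 1 <= h by rewrite ler1n.
have h0 : 0 < h by exact: lt_le_trans h1.
have hk1 : 1 <= (2 * h) ^+ k.
  by rewrite exprn_ege1// (le_trans h1)// ler_peMl ?(ltW h0)// ler1n.
have K1 : 1 <= K by rewrite /K -/h; move: (_ ^+ _) hk1 => t ?; lra.
have K0 : 0 < K by exact: lt_le_trans K1.
(* The largest [m] with [m K <= x]; since [m >= 1], rounding down loses at most a factor 2. The same
   reasoning applies to [b] below. *)
pose m := Num.truncn (x / K).
have xK0 : 0 <= x / K by rewrite divr_ge0 ?ltW.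
have /andP[m_le m_gt] := truncn_itv xK0; rewrite -/m in m_le m_gt.
have m1 : (0 < m)%N by rewrite truncn_gt0 ler_pdivlMr// mul1r.
have m0 : 0 < m%:R :> R by rewrite ltr0n.
have mK : m%:R * K <= x by rewrite -ler_pdivlMr.
have x2mK : x <= 2 * m%:R * K.
  rewrite -ler_pdivrMr//; apply/ltW/(lt_le_trans m_gt).
  by rewrite -natrM ler_nat mul2n -addnn -addn1 leq_add2l.
have hm0 : (0 < k * m)%N by rewrite muln_gt0 k0.
have hm_le : (k * m <= n)%N.
  rewrite -(ler_nat R) natrM -/h; apply: le_trans n_ge1.
  by rewrite ler_wpM2l ?(ltW h0)// (le_trans _ mK)// ler_peMr// ltW.
pose b := (n %/ (k * m))%N.
have b0 : (0 < b)%N by rewrite divn_gt0.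
have mb_ge : n%:R <= 2 * h * (m * b)%:R.
  rewrite /h -!natrM ler_nat; apply: ltnW; apply: leq_trans (ltn_ceil n hm0) _.
  have -> c : (2 * k * (m * c) = (c + c) * (k * m))%N by ring.
  by rewrite -/b leq_mul2r -addn1 leq_add2l b0 orbT.
have mb0 : 0 < (m * b)%:R :> R by rewrite ltr0n muln_gt0 m1.
exists m, b; split; split => //.
- by rewrite mulnA mulnC; exact: leq_trunc_div.
(* With [n <= 2 k m b] and [m K <= p ^- D], the bound on [u] leaves [2 (2 k) ^ k / K = 1 / 2] times
   [(m b) ^ k w]; this fixes [K]. *)
- have nmb : n%:R ^+ k <= (2 * h) ^+ k * ((m * b) ^ k)%:R.
    rewrite natrX -exprMn lerXn2r// nnegrE ?ler0n//.
    by rewrite mulr_ge0// mulr_ge0// ltW.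
  apply: (@lt_le_trans _ _ (2 * u * m%:R)).
    by rewrite ltr_pM2r// ltr_pM2r// -[2]/(1 + 1) ltrD2l.
  apply: (@le_trans _ _ (2 * (n%:R ^+ k * (w * y)) * m%:R)).
    by rewrite ler_wpM2r ?(ltW m0)// ler_wpM2l.
  rewrite -(ler_pM2r K0).
  apply: (@le_trans _ _ (2 * (n%:R ^+ k * (w * y)) * x)).
    have a0 : 0 <= 2 * (n%:R ^+ k * (w * y)).
      by rewrite mulr_ge0// mulr_ge0 ?exprn_ge0// mulr_ge0 ?ltW.
    by rewrite -[leLHS]mulrA; exact: ler_wpM2l.
  rewrite /K -/h; move: (n%:R ^+ k) ((2 * h) ^+ k) ((m * b) ^ k)%:R nmb.
  move=> s t r tr.
  have -> : 2 * (s * (w * y)) * x = 2 * w * s.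
    by rewrite -[RHS]mulr1 -xD; ring.
  have -> : r * w / 2 * (4 * t) = 2 * w * (t * r) by field.
  by rewrite ler_wpM2l// mulr_ge0 ?ltW.
(* Here [n <= 2 k m b] turns the hypothesis with [80 k ^ 2] into [40 k <= m b w ^ 2]. *)
- rewrite ler_pdivrMr ?mulr_gt0 ?exprn_gt0//.
  have z0 : 0 <= z.
    rewrite -(@pmulr_rge0 _ n%:R) ?(le_trans _ n_ge2)// ?mulr_ge0 ?exprn_ge0 ?ltW//.
    by rewrite ltr0n (leq_trans hm0).
  have : 80 * h ^+ 2 <= 2 * h * (m * b)%:R * w ^+ 2.
    by apply: (le_trans n_ge2); apply: ler_pM.
  have -> : 80 * h ^+ 2 = 2 * h * (40 * h) by ring.
  rewrite -[2 * h * _ * _]mulrA ler_pM2l ?mulr_gt0//; move: (_ * w ^+ 2) => t ?; lra.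
Qed.

(** * The lower bound with explicit constants *)

Local Open Scope classical_set_scope.

Theorem theorem4p8 (R : realType) (eps : R) (heps : 0 < eps < 1)
    (V : finType) (H : sgraph V) (hV : (1 < #|V|)%N) :
  exists (c : R) (n0 : {poly R}), 0 < c /\
    forall (p : R) (n : nat), 0 < p <= 1 / 2 -> n0.[1 / p] <= n%:R ->
    quality_control_instance eps (@Gnp R n p) (@rho R n p V H) ->
    forall (d : measure_display) (T : measurableType d) (P : probability T R)
      (A : randomized_algorithm n T),
    solves_quality_control eps (@Gnp R n p) (@rho R n p V H) P
      (fun w => accepts (A w)) ->
    ((c * p `^ (- ((max_degree H)%:R / 2)))%:E <= query_complexity R A)%E.
Proof.
have [v vmax] : exists v, max_degree H = degree H v.
  by have [v vmax] := bigop.eq_bigmax (degree H) (ltnW hV); exists v.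
rewrite vmax; have [D DE] : {D | D = degree H v} by exists (degree H v).
have [L LE] : {L | L = #|{set V}|} by exists #|{set V}|.
have [k kE] : {k | k = #|V|} by exists #|V|.
have k0 : (0 < k)%N by rewrite kE ltnW.
pose K : R := 4 * (2 * k%:R) ^+ k.
have K0 : 0 < K by rewrite mulr_gt0 ?exprn_gt0 ?mulr_gt0 ?ltr0n.
(* From [m < 20 q] and [m >= p ^- D / (2 K)] comes [c = 1 / (40 K)]. The two terms of [n0] give the
   two lower bounds on [n] in [planting_parameters]. *)
exists (40 * K)^-1, ((80 * k%:R ^+ 2) *: 'X^(2 * L) + k%:R *: 'X^D).
have K40 : 0 < 40 * K by exact: mulr_gt0.
split; first by rewrite invr_gt0.
case/andP: heps => eps0 eps1 p n p01 n_ge; rewrite hornerD !hornerZ !hornerXn div1r in n_ge.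
move=> [_ _ _ good] d T P A Asolves; rewrite leNgt; apply/negP => qc_lt.
have /andP[p0 p_le] := p01.
have p1 : p <= 1 by rewrite (le_trans p_le)// ler_pdivrMr// mul1r ler1n.
pose x := p ^- D.
have x0 : 0 < x by rewrite invr_gt0 exprn_gt0.
have powx : p `^ (- (D%:R / 2)) <= x.
  rewrite powRN /x -powR_mulrn ?(ltW p0)// lef_pV2 ?posrE ?powR_gt0//.
  by rewrite ger_powR ?p0// ler_pdivrMr// ler_peMr// ler1n.
have Aq w G : (num_queries (A w) G)%:R < (40 * K)^-1 * x.
  rewrite -lte_fin; apply: le_lt_trans (lt_le_trans qc_lt _).
    by apply: ereal_sup_ubound; exists (w, G).
  rewrite -DE lee_fin; apply: ler_wpM2l => //.
  by rewrite invr_ge0 ltW.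
(* If [mu] were 0, [rho] would vanish everywhere because division by 0 gives 0, and no graph would
   have [rho] within [eps < 1] of 1. *)
have mu0 : 0 < mu n p H.
  rewrite lt_neqAle; apply/andP; split; last first.
    apply: sumr_ge0 => G _; rewrite mulr_ge0// Gnp_ge0//.
    by rewrite ltW.
  apply/eqP => mu0; move: good; rewrite big1 => [|G].
    by apply/negP; rewrite -ltNge divr_gt0.
  by rewrite /rho -mu0 invr0 mulr0 add0r normrN normr1 leNgt eps1.
(* If [p ^- D < K], the assumed bound on the queries is below 1, so no query is made. *)
have [xK|Kx] := ltP x K.
  apply: (zero_query_not_solving eps1 hV _ Asolves) => w G.
  apply/eqP; rewrite -leqn0 -ltnS -(ltr_nat R); apply: lt_trans (Aq w G) _.
  rewrite mulrC ltr_pdivrMr// mul1r (lt_le_trans xK)//.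
  by rewrite ler_peMl ?(ltW K0)// ler1n.
have [||||m [b [[m0 b0 mbn] [x_le many tail]]]] :=
    @planting_parameters R eps p (weight p H (pairs_avoiding v)) (mu n p H)
      n k D L eps1 p0 k0 Kx.
- rewrite -ler_pdivrMr ?exprn_gt0// -exprVn; apply: le_trans n_ge.
  by rewrite lerDl mulr_ge0// exprn_ge0// invr_ge0 ltW.
- apply: le_trans n_ge; rewrite -exprVn lerDr.
  by rewrite mulr_ge0 ?mulr_ge0 ?exprn_ge0// invr_ge0 ltW.
- by rewrite LE weight_lb.
- by rewrite mu0 kE DE mu_ub.
have [iota iotaI] : exists f : V * ('I_m * 'I_b) -> 'I_n, injective f.
  by apply: inj_ord_exists; rewrite !card_prod !card_ord -kE.
rewrite kE in many tail.
have := planting_query_lower_bound p01 iotaI m0 b0 mu0 many tail Asolves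
  (fun w G => ltW (Aq w G)).
rewrite ltNge => /negP; apply.
rewrite mulrCA ler_pdivrMl//; apply: le_trans (ler_wpM2l _ x_le) _ => //.
by rewrite le_eqVlt; apply/orP; left; apply/eqP; rewrite -/K; ring.
Qed.
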